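(* Let $G, K \in \mathbf{R}\mathbf{H}_\infty^{n\times n}$. Then $(I + T^TGT\, S^TKS)^{-1} \in \mathbf{R}\mathbf{H}_\infty^{n\times n}$ for all $T, S \in \mathbb{GL}_n(\mathbb{R})$ if there exist $z \in \mathbf{L}_\infty$ (scalar-valued) and $\epsilon > 0$ such that, for all $\omega \in [0,\infty]$, at least one of the following two pairs of inequalities (a), (b) holds (which of the two holds may depend on $\omega$): (a) $$\begin{bmatrix} I & -G(j\omega)^* \end{bmatrix} \Pi(j\omega) \begin{bmatrix} I \\ -G(j\omega) \end{bmatrix} \preceq -\epsilon\, G(j\omega)^*G(j\omega) \quad\text{and}\quad \begin{bmatrix} K(j\omega)^* & I \end{bmatrix} \Pi(j\omega) \begin{bmatrix} K(j\omega) \\ I \end{bmatrix} \succeq 0;$$ (b) $$\begin{bmatrix} I & -G(j\omega)^* \end{bmatrix} \Pi(j\omega) \begin{bmatrix} I \\ -G(j\omega) \end{bmatrix} \preceq 0 \quad\text{and}\quad \begin{bmatrix} K(j\omega)^* & I \end{bmatrix} \Pi(j\omega) \begin{bmatrix} K(j\omega) \\ I \end{bmatrix} \succeq \epsilon\, K(j\omega)^*K(j\omega);$$ where $$\Pi(j\omega) := \begin{bmatrix} 0 & z(j\omega) I \\ z(j\omega)^* I & 0 \end{bmatrix}.$$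
   Context: $j^2=-1$; $I$ is the $n \times n$ identity matrix; $\cdot^*$ is the conjugate transpose (complex conjugate for scalars), $\cdot^T$ the transpose; $\preceq,\succeq$ denote the Loewner order on Hermitian matrices; $\mathbb{GL}_n(\mathbb{R})$ is the set of real invertible $n\times n$ matrices. $\mathbf{L}_\infty$ is the space of functions $\phi: j\mathbb{R} \to \mathbb{C}$ with $\operatorname{ess\,sup}_{\omega\in\mathbb{R}} |\phi(j\omega)| < \infty$. $\mathbf{R}\mathbf{H}_\infty^{n\times n}$ is the set of $n\times n$ real-rational proper transfer function matrices with no poles in the closed right-half complex plane. For such $G$, $G(j\infty)$ denotes the limit of $G(j\omega)$ as $\omega\to\infty$; $z$ is understood as a function with a specified value at every $\omega\in[0,\infty]$, including $\omega = \infty$. *)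

(* Defs.v *)
From HB Require Import structures.
From mathcomp Require Import all_boot all_order all_algebra.
From mathcomp Require Import all_classical all_reals all_analysis.
From mathcomp Require Import ess_sup_inf complex.

Set Implicit Arguments.
Unset Strict Implicit.
Unset Printing Implicit Defensive.

Import Order.TTheory GRing.Theory Num.Theory.
Import numFieldNormedType.Exports.

Local Open Scope classical_set_scope.
Local Open Scope ring_scope.
Local Open Scope complex_scope.
Local Open Scope sesquilinear_scope.

(* A real-rational transfer function is an element of the field R(s), that is
   of {fraction {poly R}}.  The representative of a fraction chosen by the
   quotient need not be in lowest terms, hence the division by the gcd. *)
Definition rf_gcd (R : realType) (f : {fraction {poly R}}) : {poly R} :=
  gcdp (repr f).1 (repr f).2.

Definition rf_num (R : realType) (f : {fraction {poly R}}) : {poly R} :=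
  (repr f).1 %/ rf_gcd f.

Definition rf_den (R : realType) (f : {fraction {poly R}}) : {poly R} :=
  (repr f).2 %/ rf_gcd f.

Definition rf_proper (R : realType) (f : {fraction {poly R}}) : Prop :=
  (size (rf_num f) <= size (rf_den f))%N.

Definition rf_pole (R : realType) (f : {fraction {poly R}}) (s : R[i]) : Prop :=
  root (map_poly (real_complex R) (rf_den f)) s.

Definition RHinf (R : realType) (n : nat)
    (G : 'M[{fraction {poly R}}]_n) : Prop :=
  forall i j : 'I_n, rf_proper (G i j) /\
    (forall s : R[i], 0 <= complex.Re s -> ~ rf_pole (G i j) s).

(* Only meaningful when s is not a pole of f. *)
Definition rf_eval (R : realType) (f : {fraction {poly R}}) (s : R[i]) : R[i] :=
  (map_poly (real_complex R) (rf_num f)).[s] /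
  (map_poly (real_complex R) (rf_den f)).[s].

(* f(jw).  The regular module R[i]^o carries the topology of the modulus.  The
   -oo branch only makes the function total. *)
Definition rf_freq (R : realType) (f : {fraction {poly R}}) (w : \bar R) :
    R[i] :=
  match w with
  | r%:E => rf_eval f (0 +i* r)
  | +oo%E => lim ((rf_eval f (0 +i* r) : R[i]^o) @[r --> +oo])
  | -oo%E => lim ((rf_eval f (0 +i* r) : R[i]^o) @[r --> -oo])
  end.

Definition freq_resp (R : realType) (n : nat) (G : 'M[{fraction {poly R}}]_n)
    (w : \bar R) : 'M[R[i]]_n :=
  map_mx (fun f => rf_freq f w) G.

Definition rf_const_mx (R : realType) (n : nat) (T : 'M[R]_n) :
    'M[{fraction {poly R}}]_n :=
  map_mx (fun x : R => tofrac x%:P) T.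

(* A function phi on the imaginary axis is given by w |-> phi(jw).
   Measurability of phi is not required, only essential boundedness. *)
Definition Linfty (R : realType) (phi : R -> R[i]) : Prop :=
  (ess_sup (@lebesgue_measure R)
     (fun w : R => (ComplexField.Normc.normc (phi w))%:E) < +oo)%E.

(* In R[i], 0 <= c means that c is real and nonnegative. *)
Definition psdmx (R : realType) (n : nat) (A : 'M[R[i]]_n) : Prop :=
  A \is hermsymmx /\ forall x : 'cV[R[i]]_n, 0 <= (x^t* *m A *m x) 0 0.

Definition loewner_le (R : realType) (n : nat) (A B : 'M[R[i]]_n) : Prop :=
  [/\ A \is hermsymmx, B \is hermsymmx & psdmx (B - A)].

(* The value of the multiplier Pi at a frequency where z takes the value c. *)
Definition multiplier (R : realType) (n : nat) (c : R[i]) :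
    'M[R[i]]_(n + n) :=
  block_mx 0 c%:M (c^*)%R%:M 0.

Definition graph_formG (R : realType) (n : nat)
    (P : 'M[R[i]]_(n + n)) (G : 'M[R[i]]_n) : 'M[R[i]]_n :=
  row_mx 1%:M (- G^t*) *m P *m col_mx 1%:M (- G).

Definition graph_formK (R : realType) (n : nat)
    (P : 'M[R[i]]_(n + n)) (K : 'M[R[i]]_n) : 'M[R[i]]_n :=
  row_mx (K^t*) 1%:M *m P *m col_mx K 1%:M.

(* Main.v *)
Require Import Defs.
From HB Require Import structures.
From mathcomp Require Import all_boot all_order all_algebra.
From mathcomp Require Import all_classical all_reals all_analysis.
From mathcomp Require Import complex perm ring lra.

Import Order.TTheory GRing.Theory Num.Theory.
Import numFieldNormedType.Exports.

Local Open Scope classical_set_scope.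
Local Open Scope ring_scope.
Local Open Scope complex_scope.
Local Open Scope sesquilinear_scope.

Set Implicit Arguments.
Unset Strict Implicit.
Unset Printing Implicit Defensive.

(** Write G = N1 / d1 and K = N2 / d2 with common denominators d1, d2 that have
    no zero in the closed right half-plane, and put d = d1 d2.  For the weight t
    in [0, 1] the loop matrix I + t T^T G T S^T K S equals (d I + t B) / d with
    B = T^T N1 T S^T N2 S a polynomial matrix.  The theorem amounts to: the real
    polynomial p_1 has no zero in the closed right half-plane, where
    p_t = det (d I + t B), and p_1 has the full degree n deg d, for then
    the inverse of the loop matrix is d adj (d I + B) / p_1.

    No zero on the imaginary axis or at infinity
    ([multiplier_nonsingular]).  If (I + t T^T G T S^T K S) v = 0 at some
    frequency, put y = S v, u = S^T K y and x = T u, so that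
    v = - t T^T G x.  Then y* K y = - t (x* G x)^*: the two quadratic forms of
    the multiplier, at x for G and at y for K, are q and - t q for the same
    real number q.  The inequalities (a) or (b) then force G x = 0 or K y = 0,
    and v = 0 in both cases.  The congruence by T and by S only moves the
    test vectors, which is why a scalar multiplier serves all T and S at once.
    Negative frequencies follow by complex conjugation; the frequency +oo sees
    the coefficients of degree deg d and gives the constancy of the degree of
    p_t.

    Homotopy ([hurwitz_homotopy]).  The polynomial p_0 = d^n is stable.  Along
    a path of polynomials of constant degree without imaginary zeros both
    stability and instability are open conditions ([hurwitz_perturb] and
    [unstable_perturb]), so stability is constant on [0, 1] and reaches p_1. *)

(** * Stable real polynomials *)

Definition hurwitz (R : realType) (p : {poly R}) : Prop :=
  forall s : R[i], 0 <= complex.Re s ->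
    ~~ root (map_poly (real_complex R) p) s.

Lemma hurwitz_neq0 (R : realType) (d : {poly R}) : hurwitz d -> d != 0.
Proof.
move=> hd; apply/eqP => d0; have /negP[] := hd 0 (lexx _).
by rewrite d0 rmorph0 root0.
Qed.

Lemma hurwitzM (R : realType) (a b : {poly R}) :
  hurwitz a -> hurwitz b -> hurwitz (a * b).
Proof. by move=> ha hb s s0; rewrite rmorphM rootM negb_or ha ?hb. Qed.

Lemma hurwitz_prod (R : realType) (I : Type) (r : seq I) (F : I -> {poly R}) :
  (forall i, hurwitz (F i)) -> hurwitz (\prod_(i <- r) F i).
Proof.
move=> hF; elim/big_ind: _ => [s _| |//]; last exact: hurwitzM.
by rewrite rmorph1 root1.
Qed.

Section HalfPlane.
Variable R : realType.
Local Notation normc := ComplexField.Normc.normc.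

Lemma normc_realE (x : R) : normc x%:C = `|x|.
Proof. by rewrite /= expr0n addr0 sqrtr_sqr. Qed.

Lemma normcX (x : R[i]) k : normc (x ^+ k) = normc x ^+ k.
Proof.
elim: k => [|k IH]; first exact: ComplexField.Normc.normc1.
by rewrite !exprS ComplexField.Normc.normcM IH.
Qed.

Lemma normc_ge0 (x : R[i]) : 0 <= normc x.
Proof. by case: x => a b; exact: sqrtr_ge0. Qed.

Lemma Re_le_normc (x : R[i]) : complex.Re x <= normc x.
Proof. 
have := normc_ge_Re x; rewrite normc_def lecR.
by case: x => a b /=; apply: le_trans; exact: ler_norm.
Qed.

Lemma ReB (x y : R[i]) :
  complex.Re (x - y) = complex.Re x - complex.Re y.
Proof. by case: x => ? ?; case: y. Qed.

Lemma normc_sum_le (n : nat) (F : 'I_n -> R[i]) :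
  normc (\sum_(i < n) F i) <= \sum_(i < n) normc (F i).
Proof.
elim/big_ind2: _ => [|x1 x2 y1 y2 h1 h2|i _ //].
- by rewrite ComplexField.Normc.normc0.
- exact: le_trans (le_normcD _ _) (lerD h1 h2).
Qed.

Lemma normc_horner_le (p : {poly R}) (N : nat) (e : R)
    (s : R[i]) :
  (size p <= N.+1)%N -> (forall k, (k < N.+1)%N -> `|p`_k| <= e) ->
  normc (map_poly (real_complex R) p).[s] <= e * N.+1%:R * (1 + normc s) ^+ N.
Proof.
move=> sp pe.
have s0 := normc_ge0 s.
have e0 : 0 <= e by exact: le_trans (pe 0%N isT).
rewrite (@horner_coef_wide _ N.+1) ?size_map_poly //.
apply: le_trans (normc_sum_le _) _.
rewrite -mulrA [X in _ * X]mulrC mulrA mulr_natr -[X in _ *+ X]card_ord.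
rewrite -sumr_const.
apply: ler_sum => i _.
rewrite coef_map /= ComplexField.Normc.normcM normc_realE normcX.
apply: ler_pM; rewrite ?exprn_ge0 ?normr_ge0 ?pe //.
apply: (@le_trans _ _ ((1 + normc s) ^+ i)).
  by rewrite lerXn2r ?nnegrE; lra.
by rewrite ler_weXn2l ?lerDl // -ltnS.
Qed.

(** The growth factor 1 + |s| makes the bound survive the comparison with
    arbitrarily large zeros of a nearby polynomial, so that no a priori bound
    on those zeros is needed. *)
Lemma left_root_dist_ge (z : R[i]) : complex.Re z < 0 ->
  exists2 k : R, 0 < k &
    forall s, 0 <= complex.Re s -> k * (1 + normc s) <= normc (s - z).
Proof.
move=> z0; have nz := normc_ge0 z.
set a := - complex.Re z; have a0 : 0 < a by rewrite oppr_gt0.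
have D0 : 0 < 1 + normc z + a by lra.
exists (a / (1 + normc z + a)); first by rewrite divr_gt0.
move=> s s0; rewrite mulrAC ler_pdivrMr //.
have h1 : a <= normc (s - z).
  by apply: le_trans (Re_le_normc _); rewrite ReB /a; lra.
have h2 : normc s <= normc (s - z) + normc z.
  by rewrite -{1}(subrK z s); exact: le_normcD.
nra.
Qed.

Lemma left_prod_ge (rs : seq R[i]) :
  (forall z, z \in rs -> complex.Re z < 0) ->
  exists2 k : R, 0 < k & forall s, 0 <= complex.Re s ->
    k * (1 + normc s) ^+ size rs <= normc (\prod_(z <- rs) (s - z)).
Proof.
elim: rs => [_|z rs IH H].
  exists 1 => // s _.
  by rewrite big_nil expr0 mulr1 ComplexField.Normc.normc1.
have [k k0 kP] := left_root_dist_ge (H z (mem_head _ _)).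
have [l l0 lP] := IH (fun w hw => H w (mem_behead (s := z :: rs) hw)).
exists (k * l); first exact: mulr_gt0.
move=> s s0; rewrite big_cons ComplexField.Normc.normcM /= exprS.
have ns := normc_ge0 s.
rewrite mulrACA; apply: ler_pM; rewrite ?kP ?lP //.
  by rewrite mulr_ge0 //; lra.
by rewrite mulr_ge0 ?exprn_ge0 //; lra.
Qed.

Lemma left_prod_ge_Re (rs : seq R[i]) (s : R[i]) :
  (forall z, z \in rs -> complex.Re z < 0) -> 0 <= complex.Re s ->
  complex.Re s ^+ size rs <= normc (\prod_(z <- rs) (s - z)).
Proof.
move=> H s0; elim: rs H => [_|z rs IH H].
  by rewrite big_nil expr0 ComplexField.Normc.normc1.
rewrite big_cons ComplexField.Normc.normcM /= exprS.
apply: ler_pM; rewrite ?exprn_ge0 //.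
  apply: le_trans (Re_le_normc _); rewrite ReB.
  have := H z (mem_head _ _); lra.
by apply: IH => w hw; apply: H; by rewrite inE hw orbT.
Qed.

Lemma hurwitz_factor (p : {poly R}) (N : nat) :
  hurwitz p -> size p = N.+1 ->
  exists rs : seq R[i],
    [/\ size rs = N, forall z, z \in rs -> complex.Re z < 0
      & forall s, normc (map_poly (real_complex R) p).[s]
                  = `|p`_N| * normc (\prod_(z <- rs) (s - z))].
Proof.
move=> hp sp; set pC := map_poly _ p.
have [rs rsE] := closed_field_poly_normal pC.
have p0 : pC != 0 by rewrite map_poly_eq0 -size_poly_eq0 sp.
have lE : lead_coef pC = (p`_N)%:C.
  by rewrite lead_coef_map lead_coefE sp.
have l0 : lead_coef pC != 0 by rewrite lead_coef_eq0.
exists rs; split.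
- have : size pC = N.+1 by rewrite size_map_poly.
  by rewrite rsE size_scale // size_prod_XsubC => -[].
- move=> z zrs; rewrite ltNge; apply/negP => /hp/negP; apply.
  by rewrite -/pC rsE rootZ // root_prod_XsubC.
- move=> s; rewrite rsE hornerZ lE ComplexField.Normc.normcM normc_realE.
  congr (_ * normc _); rewrite horner_prod.
  by apply: eq_bigr => z _; rewrite hornerXsubC.
Qed.

(** A stable p of degree N satisfies c (1 + |s|)^N <= |p(s)| on the closed right
    half-plane, and a perturbation of the coefficients by e changes the value by
    at most e (N + 1) (1 + |s|)^N. *)
Lemma hurwitz_perturb (p : {poly R}) (N : nat) :
  hurwitz p -> size p = N.+1 ->
  exists2 e : R, 0 < e & forall q : {poly R}, (size q <= N.+1)%N ->
    (forall k, (k < N.+1)%N -> `|q`_k - p`_k| < e) -> hurwitz q.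
Proof.
move=> hp sp; have [rs [srs rsL pE]] := hurwitz_factor hp sp.
have [k k0 kP] := left_prod_ge rsL.
have c0 : 0 < `|p`_N|.
  by rewrite normr_gt0 -[N]/(N.+1.-1) -sp lead_coef_eq0 -size_poly_eq0 sp.
exists (`|p`_N| * k / N.+2%:R); first by rewrite divr_gt0 ?mulr_gt0 ?ltr0Sn.
move=> q sq qp s s0; apply/negP => /rootP qs.
have := normc_horner_le (p := p - q) (N := N) (e := `|p`_N| * k / N.+2%:R) s.
rewrite rmorphB hornerD hornerN qs subr0 pE => h.
have {h}h := h (leq_trans (size_polyD _ _) _) _.
have {}h : `|p`_N| * normc (\prod_(z <- rs) (s - z)) <=
   `|p`_N| * k / N.+2%:R * N.+1%:R * (1 + normc s) ^+ N.
  apply: h; first by rewrite size_polyN geq_max sp leqnn.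
  by move=> j jN; rewrite coefB distrC ltW ?qp.
have := le_trans (ler_wpM2l (ltW c0) (kP s s0)) h.
have ns := normc_ge0 s.
have X0 : 0 < (1 + normc s) ^+ N by rewrite exprn_gt0 ?ltr_pwDl.
rewrite srs mulrA ler_pM2r // mulrAC ler_pdivlMr ?ltr0Sn //.
rewrite ler_pM2l ?mulr_gt0 //.
by rewrite ler_nat ltnn.
Qed.

(** If q is stable, its zeros lie at distance at least Re r from r, so that
    |q(r)| >= |q_N| (Re r)^N; for q close to p this contradicts p(r) = 0. *)
Lemma unstable_perturb (p : {poly R}) (N : nat) (r : R[i]) :
  size p = N.+1 -> root (map_poly (real_complex R) p) r -> 0 < complex.Re r ->
  exists2 e : R, 0 < e & forall q : {poly R}, size q = N.+1 ->
    (forall k, (k < N.+1)%N -> `|q`_k - p`_k| < e) -> ~ hurwitz q.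
Proof.
move=> sp /rootP pr r0.
have c0 : 0 < `|p`_N|.
  by rewrite normr_gt0 -[N]/(N.+1.-1) -sp lead_coef_eq0 -size_poly_eq0 sp.
have nr := normc_ge0 r.
set A := complex.Re r ^+ N; have A0 : 0 < A by rewrite exprn_gt0.
set B := N.+1%:R * (1 + normc r) ^+ N.
have B0 : 0 < B by rewrite mulr_gt0 ?ltr0Sn ?exprn_gt0 ?ltr_pwDl.
have D0 : 0 < A + B + 1 by rewrite !addr_gt0.
(* With this e, a stable q would give (|p_N| - e) A < |q_N| A <= e B. *)
set e := `|p`_N| * A / (A + B + 1).
have eE : e * (A + B + 1) = `|p`_N| * A by rewrite mulfVK // lt0r_neq0.
have e0 : 0 < e by rewrite divr_gt0 ?mulr_gt0.
exists e => // q sq qp hq.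
have [rs [srs rsL qE]] := hurwitz_factor hq sq.
have := normc_horner_le (p := q - p) (N := N) (e := e) r.
rewrite rmorphB hornerD hornerN pr subr0 qE -mulrA -/B => h.
have {h}h := h (leq_trans (size_polyD _ _) _) _.
have {}h : `|q`_N| * normc (\prod_(z <- rs) (r - z)) <= e * B.
  apply: h; first by rewrite size_polyN geq_max sp sq leqnn.
  by move=> j jN; rewrite coefB ltW ?qp.
have := le_trans (ler_wpM2l (normr_ge0 _) (left_prod_ge_Re rsL (ltW r0))) h.
rewrite srs -/A => {}h.
have {qp}qp := qp N (ltnSn N); clear sp sq srs.
have : `|p`_N| - e < `|q`_N|.
  have := ler_normD q`_N (p`_N - q`_N); rewrite [q`_N + _]addrC subrK distrC.
 
  lra.
nra.
Qed.

(** The indicator function of f is continuous on [0, 1] and omits the value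
    1/2. *)
Lemma locally_constant_unit_interval (f : R -> Prop) :
  (forall t : R, 0 <= t <= 1 ->
     \forall u \near t, (0 <= u <= 1 -> (f u <-> f t))) ->
  f 0 -> f 1.
Proof.
move=> loc f0; apply: contrapT => f1.
pose g (t : R) : R := if `[< f t >] then 1 else 0.
have gc : {within `[0, 1], continuous g}.
  apply/subspace_continuousP => t /=; rewrite in_itv /= => t01.
  apply: cvg_near_cst; have := loc t t01.
  rewrite /within /=; apply: filterS => u hu.
  rewrite /= in_itv /= => u01.
  by rewrite /g /from_subspace (asbool_equiv_eq (hu u01)).
have g0 : g 0 = 1 by rewrite /g asboolT.
have g1 : g 1 = 0 by rewrite /g asboolF.
have [|c _] := IVT (v := 2^-1) ler01 gc.
  by rewrite g0 g1 minEle maxElt ler10 ltr10 /=; lra.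
by rewrite /g; case: ifP => _; lra.
Qed.

(** The path is the specialization t |-> Q(t, -) of a polynomial in two
    variables; its coefficients are then polynomials in t, hence continuous.
    The hypothesis on the coefficient of index N forbids zeros escaping to
    infinity. *)
Lemma hurwitz_homotopy (Q : {poly {poly R}}) (N : nat) :
  let P t := map_poly (horner_eval t) Q in
  (size Q <= N.+1)%N ->
  (forall t, 0 <= t <= 1 -> (P t)`_N != 0) ->
  (forall t, 0 <= t <= 1 -> forall w : R,
     ~~ root (map_poly (real_complex R) (P t)) (0 +i* w)) ->
  hurwitz (P 0) -> hurwitz (P 1).
Proof.
move=> P sQ lead axis.
have coefP t k : (P t)`_k = (Q`_k).[t] by rewrite coef_map.
have sP t : (size (P t) <= N.+1)%N by exact: leq_trans (size_poly _ _) sQ.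
have sPe t : 0 <= t <= 1 -> size (P t) = N.+1.
  move=> t01; apply/eqP; rewrite eqn_leq sP ltnNge; apply: contra (lead t t01).
  by move=> h; rewrite nth_default.
apply: (@locally_constant_unit_interval (fun t => hurwitz (P t))) => t t01.
have close e : 0 < e -> \forall u \near t,
    forall k, (k < N.+1)%N -> `|(P u)`_k - (P t)`_k| < e.
  move=> e0.
  have : \forall u \near t, forall k : 'I_N.+1, `|(P u)`_k - (P t)`_k| < e.
    apply: (@filter_forall R _ _ (nbhs (t : R)) _) => k.
    have /cvgr_distC_lt/(_ _ e0) := @continuous_horner _ Q`_k t.
    by apply: filterS => u; rewrite !coefP.
  by apply: filterS => u hu k kN; exact: (hu (Ordinal kN)).
have [ht|ht] := pselect (hurwitz (P t)).
  have [e e0 He] := hurwitz_perturb ht (sPe t t01).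
  apply: filterS (close e e0) => u hu u01.
  by split=> // _; apply: He.
have [s s0 rs] : exists2 s : R[i], 0 <= complex.Re s &
    root (map_poly (real_complex R) (P t)) s.
  apply: contrapT => H; apply: ht => s s0; apply/negP => rs.
  by apply: H; exists s.
have {}s0 : 0 < complex.Re s.
  rewrite lt_neqAle s0 andbT; apply/negP => /eqP s1.
  have := axis t t01 (complex.Im s).
  by rewrite [_ +i* _](_ : _ = s) ?rs // s1; case: (s).
have [e e0 He] := unstable_perturb (sPe t t01) rs s0.
apply: filterS (close e e0) => u hu u01.
by split=> // hPu; case: (He _ (sPe u u01) hu).
Qed.

End HalfPlane.

(** * Nonsingularity of the loop from the multiplier inequalities *)

Section QuadraticForms.
Local Close Scope complex_scope.
Variable C : numClosedFieldType.

Lemma adjmxM m n p (A : 'M[C]_(m, n)) (B : 'M[C]_(n, p)) :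
  (A *m B)^t* = B^t* *m A^t*.
Proof. by rewrite trmx_mul map_mxM. Qed.

Lemma sqnorm_ge0 n (x : 'cV[C]_n) : 0 <= (x^t* *m x) 0 0.
Proof.
by rewrite !mxE sumr_ge0 // => i _; rewrite !mxE mulrC mul_conjC_ge0.
Qed.

Lemma sqnorm_le0 n (x : 'cV[C]_n) : (x^t* *m x) 0 0 <= 0 -> x = 0.
Proof.
move=> x0; have : (x^t* *m x) 0 0 == 0 by rewrite eq_le x0 sqnorm_ge0.
rewrite mxE psumr_eq0 => [/allP x_eq0|i _]; last first.
  by rewrite !mxE mulrC mul_conjC_ge0.
apply/matrixP => i j; rewrite ord1 !mxE.
by have := x_eq0 i (mem_index_enum _); rewrite !mxE mulrC mul_conjC_eq0 => /eqP.
Qed.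

Lemma scalar_adj (A : 'M[C]_1) : A^t* 0 0 = (A 0 0)^*.
Proof. by rewrite !mxE. Qed.

Definition quad n (A : 'M[C]_n) (x : 'cV[C]_n) : C := (x^t* *m A *m x) 0 0.

Lemma quadN n (A : 'M[C]_n) x : quad (- A) x = - quad A x.
Proof. by rewrite /quad mulmxN mulNmx mxE. Qed.

Lemma quad0 n (x : 'cV[C]_n) : quad 0 x = 0.
Proof. by rewrite /quad mulmx0 mul0mx mxE. Qed.

Lemma quadD n (A B : 'M[C]_n) x : quad (A + B) x = quad A x + quad B x.
Proof. by rewrite /quad mulmxDr mulmxDl mxE. Qed.

Lemma quadZ n c (A : 'M[C]_n) x : quad (c *: A) x = c * quad A x.
Proof. by rewrite /quad -scalemxAr -scalemxAl mxE. Qed.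

Lemma quad_adj n (A : 'M[C]_n) x : quad (A^t*) x = (quad A x)^*.
Proof. by rewrite /quad -scalar_adj !adjmxM trmxCK mulmxA. Qed.

Lemma quad_gram n (A : 'M[C]_n) x :
  quad (A^t* *m A) x = ((A *m x)^t* *m (A *m x)) 0 0.
Proof. by rewrite /quad adjmxM !mulmxA. Qed.

(** For v in the kernel, with y = S v, u = S* K y and x = T u, the equation
    v = - t T* G x turns y* K y = v* u into - t (x* G x)^*.  Hence
    qK y = - t qG x, and two nonnegative numbers of opposite signs vanish: the
    inequality that carries e kills G x or K y, and either one kills v. *)
Lemma feedback_nonsingular n (G K T S : 'M[C]_n) (c e t : C) :
  0 < e -> 0 <= t ->
  let qG x := c * quad G x + (c * quad G x)^* in
  let qK y := c^* * quad K y + (c^* * quad K y)^* in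
  (forall x, e * ((G *m x)^t* *m (G *m x)) 0 0 <= qG x)
    /\ (forall y, 0 <= qK y)
  \/ (forall x, 0 <= qG x)
    /\ (forall y, e * ((K *m y)^t* *m (K *m y)) 0 0 <= qK y) ->
  \det (1%:M + t *: (T^t* *m G *m T *m (S^t* *m K *m S))) != 0.
Proof.
move=> e0 t0 qG qK ab; rewrite -det_tr; apply/det0P => -[v' v'0 v'K].
pose v : 'cV_n := v'^T.
have vK : v = - (t *: (T^t* *m G *m T *m (S^t* *m K *m S) *m v)).
  move/(congr1 trmx): v'K; rewrite trmx_mul trmxK trmx0 mulmxDl mul1mx.
  by rewrite -scalemxAl => /eqP; rewrite addr_eq0 => /eqP.
have {v'0 v'K}v0 : v <> 0.
  by move=> /(congr1 trmx); rewrite trmxK trmx0 => /eqP; rewrite (negPf v'0).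
clearbody v; apply: v0.
pose y := S *m v; pose u := S^t* *m (K *m y); pose x := T *m u.
have {}vK : v = - (t *: (T^t* *m (G *m x))).
  by rewrite {1}vK /x /u /y !mulmxA.
have bE : quad K y = - (t * (quad G x)^*).
  have bu : quad K y = (v^t* *m u) 0 0 by rewrite /quad /u adjmxM !mulmxA.
  rewrite bu -[u]trmxCK -adjmxM scalar_adj {1}vK mulmxN -scalemxAr.
  rewrite mxE [X in (- X)^*]mxE.
  rewrite rmorphN rmorphM /= (geC0_conj t0); congr (- (_ * _^*)).
  by rewrite /quad /x (adjmxM T u) -!mulmxA.
have qKE : qK y = - (t * qG x).
  rewrite /qK bE /qG !mulrN rmorphN /= !rmorphM /= !conjCK (geC0_conj t0).
  by rewrite -opprD mulrDr addrC; congr (- (_ + _)); rewrite mulrCA.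
case: ab => -[/(_ x) hG /(_ y) hK].
- move: hK; rewrite qKE oppr_ge0 => hK.
  (* At t = 0 the inequality hK says nothing about qG x, but v = 0. *)
  move: t0; rewrite le_eqVlt => /predU1P[t0|t0].
    by rewrite vK -t0 scale0r oppr0.
  have q0 : qG x <= 0 by move: hK; rewrite pmulr_rle0.
  have /sqnorm_le0 Gx : ((G *m x)^t* *m (G *m x)) 0 0 <= 0.
    by rewrite -(pmulr_rle0 _ e0); exact: le_trans hG q0.
  by rewrite vK Gx mulmx0 scaler0 oppr0.
- have /sqnorm_le0 Ky : ((K *m y)^t* *m (K *m y)) 0 0 <= 0.
    rewrite -(pmulr_rle0 _ e0); apply: le_trans hK _.
    by rewrite qKE oppr_le0 mulr_ge0.
  by rewrite vK /x /u Ky !mulmx0 scaler0 oppr0.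
Qed.

End QuadraticForms.

Section Multiplier.
Variables (R : realType) (n : nat).
Implicit Types (G K T S : 'M[R[i]]_n) (c : R[i]).

Lemma graph_formG_multiplier c G :
  graph_formG (multiplier n c) G = - (c *: G + (c^*)%R *: G^t*).
Proof.
rewrite /graph_formG /multiplier mul_row_block !mulmx0 !add0r addr0.
rewrite mul_row_col !mulmx1 mul1mx mulmxN mul_scalar_mx mulNmx mul_mx_scalar.
by rewrite opprD addrC.
Qed.

Lemma graph_formK_multiplier c K :
  graph_formK (multiplier n c) K = (c^*)%R *: K + c *: K^t*.
Proof.
rewrite /graph_formK /multiplier mul_row_block !mulmx0 !add0r addr0.
by rewrite mul_row_col !mulmx1 mul1mx mul_scalar_mx mul_mx_scalar.
Qed.

Lemma quad_graph_formG c G x :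
  quad (graph_formG (multiplier n c) G) x
  = - (c * quad G x + (c * quad G x)^*)%R.
Proof.
by rewrite graph_formG_multiplier quadN quadD !quadZ quad_adj rmorphM.
Qed.

Lemma quad_graph_formK c K x :
  quad (graph_formK (multiplier n c) K) x
  = (c^* * quad K x + (c^* * quad K x)^*)%R.
Proof.
by rewrite graph_formK_multiplier quadD !quadZ quad_adj rmorphM /= conjCK.
Qed.

Lemma loewner_quad (A B : 'M[R[i]]_n) x :
  loewner_le A B -> quad A x <= quad B x.
Proof. by case=> _ _ [_ /(_ x)]; rewrite -/(quad _ x) quadD quadN subr_ge0. Qed.

Lemma multiplier_nonsingular G K T S c (e t : R) : 0 < e -> 0 <= t ->
  let P := multiplier n c in
  (loewner_le (graph_formG P G) (- (e%:C *: (G^t* *m G)))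
   /\ loewner_le 0 (graph_formK P K))
  \/ (loewner_le (graph_formG P G) 0
   /\ loewner_le (e%:C *: (K^t* *m K)) (graph_formK P K)) ->
  \det (1%:M + t%:C *: (T^t* *m G *m T *m (S^t* *m K *m S))) != 0.
Proof.
move=> e0 t0 P ab; apply: (@feedback_nonsingular _ n G K T S c e%:C).
- by rewrite ltcR.
- by rewrite lecR.
case: ab => -[hG hK]; [left|right]; split=> x.
- have := loewner_quad x hG; rewrite quad_graph_formG quadN quadZ quad_gram.
  by rewrite lerN2.
- by have := loewner_quad x hK; rewrite quad_graph_formK quad0.
- by have := loewner_quad x hG; rewrite quad_graph_formG quad0 oppr_le0.
- by have := loewner_quad x hK; rewrite quad_graph_formK quadZ quad_gram.
Qed.

End Multiplier.

(** Passes from the polynomial pencil to the loop matrix: a and b stand for the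
    values, or at infinity the top coefficients, of the two denominators. *)
Lemma feedback_det (C : fieldType) n (a b t : C) (X Y U V U' V' : 'M[C]_n) :
  a != 0 -> b != 0 ->
  \det ((a * b)%:M + t *: (U' *m X *m U *m (V' *m Y *m V)))
  = (a * b) ^+ n *
    \det (1%:M + t *: (U' *m (a^-1 *: X) *m U *m (V' *m (b^-1 *: Y) *m V))).
Proof.
move=> a0 b0; rewrite -detZ scalerDr scale_scalar_mx mulr1.
congr (\det (_ + _)).
rewrite -!(scalemxAr, scalemxAl) !scalerA; congr (_ *: _).
by field; rewrite a0 b0.
Qed.

(** * Polynomials near infinity *)

Section HornerAtInfinity.
Variables (K : numFieldType) (T : Type) (F : set_system T).
Context {FF : Filter F}.
Variable s : T -> K.
Hypothesis s_neq0 : \forall x \near F, s x != 0.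
Hypothesis sV0 : (s x)^-1 @[x --> F] --> (0 : K).

(** Induction on D along the Horner scheme:
    (q(s) s + c) / s^(D+1) = q(s) / s^D + c s^-(D+1), whose last term vanishes
    in the limit. *)
Lemma cvg_horner_div (p : {poly K}) D : (size p <= D.+1)%N ->
  p.[s x] / s x ^+ D @[x --> F] --> (p`_D : K).
Proof.
elim: D p => [|D IH] p sp.
  rewrite (size1_polyC sp) coefC /=.
  by under eq_cvg do rewrite hornerC expr0 divr1; exact: cvg_cst.
elim/poly_ind: p sp => [_|q c _ sq].
  by rewrite coef0; under eq_cvg do rewrite horner0 mul0r; exact: cvg_cst.
have {}sq : (size q <= D.+1)%N.
  by move: sq; rewrite size_MXaddC; case: ifP => [/andP[/eqP -> _]|_];
    rewrite ?size_poly0.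
have c0 E : c * (s x)^-1 ^+ E.+1 @[x --> F] --> (0 : K).
  elim: E => [|E IHE].
    by rewrite -[X in _ --> X](mulr0 c); exact: cvgMl_tmp.
  have -> : (fun x => c * (s x)^-1 ^+ E.+2)
          = (fun x => c * (s x)^-1 ^+ E.+1 * (s x)^-1).
    by apply/funext => x; rewrite [_ ^+ E.+2]exprSr mulrA.
  by rewrite -[X in _ --> X](mulr0 (0 : K)); exact: cvgM IHE sV0.
rewrite coefD coefMX coefC /=.
have lim : q.[s x] / s x ^+ D + c * (s x)^-1 ^+ D.+1 @[x --> F]
    --> (q`_D + 0 : K).
  by apply: cvgD; [exact: IH | exact: c0].
apply: cvg_trans lim; apply: near_eq_cvg.
apply: filterS s_neq0 => x sx.
rewrite hornerMXaddC mulrDl exprVn; congr (_ + _).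
by rewrite exprSr invfM -mulrA [s x * _]mulrC -mulrA mulVf // mulr1.
Qed.

Lemma cvg_horner_ratio (p q : {poly K}) D :
  (size p <= D.+1)%N -> size q = D.+1 ->
  (\forall x \near F, q.[s x] != 0) /\
  p.[s x] / q.[s x] @[x --> F] --> (p`_D / q`_D : K).
Proof.
move=> sp sq; have q0 : q`_D != 0.
  by rewrite -[D]/(D.+1.-1) -sq lead_coef_eq0 -size_poly_eq0 sq.
have cp := cvg_horner_div sp.
have cq := cvg_horner_div (eq_leq sq).
have qs0 : \forall x \near F, q.[s x] / s x ^+ D != 0.
  exact: (cvgr_neq0 _ cq q0).
split.
  apply: filterS qs0 => x; apply: contra => /eqP ->; by rewrite mul0r.
apply: cvg_trans (cvgM cp (cvgV q0 cq)); apply: near_eq_cvg.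
apply: filterS2 s_neq0 qs0 => x sx qx /=.
by rewrite /unstable.inv_fun invf_div -mulrA mulKf // expf_neq0.
Qed.

End HornerAtInfinity.

(** * Real-rational functions and their frequency responses *)

Section RationalFunctions.
Variable R : realType.
Implicit Types (a b d : {poly R}) (f : {fraction {poly R}}).
Local Notation "a %:F" := (FracField.tofrac a).
Local Notation toC := (map_poly (real_complex R)).

Lemma frac_reprE f : f = (repr f).1%:F / (repr f).2%:F.
Proof.
have d0 : (repr f).2 != 0 by exact: denom_ratioP.
apply: (canRL (mulfK _)); first by rewrite tofrac_eq0.
rewrite -{1}(reprK f); move: (repr f) d0 => x d0.
rewrite !piE; apply/eqmodP; rewrite /= FracField.equivfE /FracField.mulf.
by rewrite !numden_Ratio ?oner_eq0 ?mulf_neq0 ?oner_neq0 ?mulr1 // mulrC.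
Qed.

Lemma rf_gcd_neq0 f : rf_gcd f != 0.
Proof. by rewrite gcdp_eq0 negb_and [X in _ || X]denom_ratioP orbT. Qed.

Lemma rf_numK f : rf_num f * rf_gcd f = (repr f).1.
Proof. by rewrite divpK // dvdp_gcdl. Qed.

Lemma rf_denK f : rf_den f * rf_gcd f = (repr f).2.
Proof. by rewrite divpK // dvdp_gcdr. Qed.

Lemma rf_den_neq0 f : rf_den f != 0.
Proof.
have : (repr f).2 != 0 by exact: denom_ratioP.
by rewrite -rf_denK mulf_eq0 negb_or => /andP[].
Qed.

Lemma rf_coprime f : coprimep (rf_num f) (rf_den f).
Proof.
apply: coprimep_div_gcd; rewrite orbC.
by rewrite [X in X || _]denom_ratioP.
Qed.

Lemma rf_num_den f : f = (rf_num f)%:F / (rf_den f)%:F.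
Proof.
rewrite {1}[f]frac_reprE -rf_numK -rf_denK !tofracM.
by rewrite -mulf_div divff ?mulr1 // tofrac_eq0 rf_gcd_neq0.
Qed.

(** Gauss: a den(f) = b num(f) with num(f) and den(f) coprime.  Poles,
    properness and values, all defined from the reduced representative, become
    computable from any fraction. *)
Lemma rf_lowest_terms f a b : b != 0 -> f = a%:F / b%:F ->
  exists2 c, a = c * rf_num f & b = c * rf_den f.
Proof.
move=> b0 fE; have d0 := rf_den_neq0 f.
have ab : a * rf_den f = b * rf_num f.
  apply/eqP; rewrite -tofrac_eq !tofracM -subr_eq0; apply/eqP.
  have : a%:F / b%:F = (rf_num f)%:F / (rf_den f)%:F by rewrite -rf_num_den.
  move/eqP; rewrite eqr_div ?tofrac_eq0 // => /eqP ->.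
  by rewrite mulrC subrr.
have /dvdpP[c bE] : rf_den f %| b.
  have := rf_coprime f; rewrite coprimep_sym => /Gauss_dvdpl <-.
  by rewrite -ab dvdp_mulIr.
exists c => //; apply: (mulIf d0).
by rewrite ab bE mulrAC.
Qed.

Lemma rf_evalE f a b (s : R[i]) : f = a%:F / b%:F -> ~~ root (toC b) s ->
  rf_eval f s = (toC a).[s] / (toC b).[s].
Proof.
move=> fE bs; have b0 : b != 0.
  by apply: contra bs => /eqP ->; rewrite rmorph0 root0.
have [c aE bE] := rf_lowest_terms b0 fE.
move: bs; rewrite /rf_eval aE bE !rmorphM !hornerM rootM negb_or => /andP[cs _].
by rewrite -mulf_div divff ?mul1r.
Qed.

(** Membership in RHinf read off from one fraction N / d that need not be in
    lowest terms, neither entrywise nor as a matrix; this makes the closed loop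
    a polynomial matrix over a single stable polynomial. *)
Definition common_denominator n (G : 'M[{fraction {poly R}}]_n) d
    (N : 'M[{poly R}]_n) : Prop :=
  [/\ hurwitz d, forall i j, (size (N i j) <= size d)%N
    & forall i j, G i j = (N i j)%:F / d%:F].

Lemma RHinf_common_denominator n (G : 'M[{fraction {poly R}}]_n) :
  RHinf G -> exists d N, common_denominator G d N.
Proof.
move=> HG; pose D (p : 'I_n * 'I_n) := rf_den (G p.1 p.2).
pose d := \prod_(p : 'I_n * 'I_n) D p.
pose N := \matrix_(i, j) (rf_num (G i j) * \prod_(p | p != (i, j)) D p).
exists d, N.
have dE i j : d = D (i, j) * \prod_(p | p != (i, j)) D p.
  by rewrite /d (bigD1 (i, j)).
have D0 p : D p != 0 by exact: rf_den_neq0.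
have P0 i j : \prod_(p | p != (i, j)) D p != 0.
  by apply/prodf_neq0 => p _.
split.
- apply: hurwitz_prod => -[i j] s s0; apply/negP.
  by have [_] := HG i j; apply.
- move=> i j; rewrite (dE i j) mxE; have [pr _] := HG i j.
  have [->|n0] := eqVneq (rf_num (G i j)) 0.
    by rewrite mul0r size_poly0.
  rewrite !size_mul // -!subn1 leq_sub2r // leq_add2r; exact: pr.
- move=> i j; rewrite {1}[G i j]rf_num_den (dE i j) mxE !tofracM.
  by rewrite -mulf_div divff ?mulr1 // tofrac_eq0.
Qed.

Lemma common_denominator_RHinf n (G : 'M[{fraction {poly R}}]_n) d N :
  common_denominator G d N -> RHinf G.
Proof.
case=> hd sN GE i j; have d0 := hurwitz_neq0 hd.
have [c NE dE] := rf_lowest_terms d0 (GE i j).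
have c0 : c != 0 by apply: contra d0 => /eqP c0; rewrite dE c0 mul0r.
split.
- rewrite /rf_proper; have [->|n0] := eqVneq (rf_num (G i j)) 0.
    by rewrite size_poly0.
  have := sN i j; rewrite NE dE !size_mul ?rf_den_neq0 //.
  have : (0 < size c)%N by rewrite size_poly_gt0.
  case: (size c) => // k _; rewrite !addSn /= leq_add2l; exact.
- move=> s s0; rewrite /rf_pole => rs; have /negP := hd s s0; apply.
  by rewrite dE rmorphM rootM rs orbT.
Qed.

Lemma cvg_imaginary_axis_inv :
  (((0 +i* r)^-1 : R[i]^o) @[r --> +oo] --> (0 : R[i]^o)).
Proof.
apply/cvgr0Pnorm_lt => e e0.
have [e' e'E] : exists e', e = e'%:C by apply/complex_realP/ger0_real/ltW.
move: e0; rewrite e'E ltcR => e0; near=> r.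
have r0 : 0 < r by near: r; exact: nbhs_pinfty_gt.
rewrite normfV normc_def /= expr0n add0r sqrtr_sqr gtr0_norm // -fmorphV ltcR.
rewrite invf_plt ?posrE //; near: r; exact: nbhs_pinfty_gt.
Unshelve. all: by end_near. Qed.

(** The value of f at j r is a(j r) / b(j r) only where b does not vanish, which
    holds for large r since b(s) / s^D has a nonzero limit. *)
Lemma rf_freq_pinfty (f : {fraction {poly R}}) a b D :
  f = a%:F / b%:F -> (size a <= D.+1)%N -> size b = D.+1 ->
  rf_freq f +oo%E = (a`_D)%:C / (b`_D)%:C.
Proof.
move=> fE sa sb; rewrite /rf_freq.
have lim_unique := @cvg_lim R[i]^o (@norm_hausdorff _ _) R +oo
  (@proper_pinfty_nbhs R) (fun r => rf_eval f (0 +i* r)).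
apply: lim_unique.
have s0 : \forall r \near +oo, (0 +i* r : R[i]^o) != 0.
  near=> r; have : 0 < r by near: r; exact: nbhs_pinfty_gt.
  by rewrite eq_complex /= eqxx /= => /lt0r_neq0.
have [bs lim] := @cvg_horner_ratio R[i] R +oo _ (fun r => 0 +i* r)
  s0 cvg_imaginary_axis_inv (toC a) (toC b) D
  (eq_ind_r (fun k => (k <= D.+1)%N) sa (size_map_poly _ a))
  (etrans (size_map_poly _ b) sb).
rewrite !coef_map in lim.
apply: cvg_trans lim; apply: near_eq_cvg; apply: filterS bs => r br.
by rewrite (rf_evalE fE).
Unshelve. all: by end_near. Qed.

End RationalFunctions.

(** * Degrees of polynomial determinants *)

Section TopCoefficients.
Variable A : comNzRingType.
Implicit Types (p q : {poly A}) (D E : nat).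

Lemma coefM_top p q D E : (size p <= D.+1)%N -> (size q <= E.+1)%N ->
  (p * q)`_(D + E) = p`_D * q`_E.
Proof.
move=> sp sq; rewrite coefM.
rewrite (bigD1 (Ordinal (leq_addr E D : D < (D + E).+1)%N)) //=.
rewrite addKn big1 ?addr0 // => i.
rewrite -val_eqE /= neq_ltn => /orP[iD|Di].
  rewrite [q`__]nth_default ?mulr0 //; apply: leq_trans sq _.
  by rewrite ltn_subRL ltn_add2r.
by rewrite nth_default ?mul0r //; apply: leq_trans sp _.
Qed.

Lemma size_mul_top p q D E : (size p <= D.+1)%N -> (size q <= E.+1)%N ->
  (size (p * q)%R <= (D + E).+1)%N.
Proof.
move=> sp sq; apply: leq_trans (size_polyMleq _ _) _.
by rewrite -subn1 leq_subLR add1n -addSn -addnS leq_add.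
Qed.

Lemma prod_top (I : Type) (r : seq I) (F : I -> {poly A}) D :
  (forall i, size (F i) <= D.+1)%N ->
  (size (\prod_(i <- r) F i)%R <= (size r * D).+1)%N /\
  (\prod_(i <- r) F i)`_(size r * D) = \prod_(i <- r) (F i)`_D.
Proof.
move=> sF; elim: r => [|i r [IHs IHc]] /=.
  by rewrite !big_nil size_poly1 mul0n coef1.
by rewrite !big_cons mulSn size_mul_top ?coefM_top ?IHc.
Qed.

(** D is a bound on the degrees of the entries, not the actual degree: products
    and determinants then commute with taking top coefficients, even when some
    of these vanish. *)
Definition top_mx m n D (M : 'M[{poly A}]_(m, n)) : 'M[A]_(m, n) :=
  map_mx (fun p : {poly A} => p`_D) M.

Lemma mulmx_top m n k D E (M : 'M[{poly A}]_(m, n)) (N : 'M[{poly A}]_(n, k)) :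
  (forall i j, size (M i j) <= D.+1)%N ->
  (forall i j, size (N i j) <= E.+1)%N ->
  (forall i j, size ((M *m N)%R i j) <= (D + E).+1)%N /\
  top_mx (D + E) (M *m N) = top_mx D M *m top_mx E N.
Proof.
move=> sM sN; split.
  move=> i j; rewrite mxE; apply: leq_trans (size_sum _ _ _) _.
  by apply/bigmax_leqP => l _; exact: size_mul_top.
apply/matrixP => i j; rewrite !mxE coef_sum; apply: eq_bigr => l _.
by rewrite !mxE coefM_top.
Qed.

Lemma det_top n D (M : 'M[{poly A}]_n) :
  (forall i j, size (M i j) <= D.+1)%N ->
  (size (\det M)%R <= (n * D).+1)%N /\ (\det M)`_(n * D) = \det (top_mx D M).
Proof.
move=> sM.
have top (s : 'S_n) := @prod_top _ (index_enum 'I_n) (fun i => M i (s i)) D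
  (fun i => sM i (s i)).
have En : size (index_enum 'I_n) = n.
  by rewrite -[RHS]card_ord cardE enumT; congr size; rewrite unlock.
rewrite En in top; split.
  apply: leq_trans (size_sum _ _ _) _; apply/bigmax_leqP => s _.
  by have [h _] := top s; rewrite mulr_sign; case: ifP; rewrite ?size_polyN.
rewrite coef_sum; apply: eq_bigr => s _.
have [_ h] := top s; rewrite !mulr_sign.
under [in RHS]eq_bigr do rewrite mxE.
by case: ifP; rewrite ?coefN h.
Qed.

Lemma size_adj n D (M : 'M[{poly A}]_n) i j :
  (forall i j, size (M i j) <= D.+1)%N ->
  (size ((\adj M)%R i j) <= (n.-1 * D).+1)%N.
Proof.
move=> sM; rewrite mxE /cofactor -signr_odd mulr_sign.
have [|sdet _] := @det_top _ D (row' j (col' i M)).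
  by move=> k l; rewrite !mxE; exact: sM.
by case: ifP; rewrite ?size_polyN.
Qed.

End TopCoefficients.

(** * The closed loop *)

(** Cramer's rule for (d I + B) / d, where f maps polynomials to fractions. *)
Lemma pencil_mul_inverse (A : comNzRingType) (F : fieldType)
    (f : {rmorphism A -> F}) n (d : A) (B : 'M[A]_n) :
  let p := \det (d%:M + B) in f d != 0 -> f p != 0 ->
  (1%:M + (f d)^-1 *: map_mx f B) *m
    ((f d / f p) *: map_mx f (\adj (d%:M + B))) = 1%:M.
Proof.
move=> p d0 p0.
have -> : 1%:M + (f d)^-1 *: map_mx f B = (f d)^-1 *: map_mx f (d%:M + B).
  by rewrite map_mxD map_scalar_mx scalerDr scale_scalar_mx mulVf.
rewrite -scalemxAl -scalemxAr -map_mxM mul_mx_adj map_scalar_mx.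
by rewrite scalerA mulrA mulVf // mul1r scale_scalar_mx mulVf.
Qed.

Section ClosedLoop.
Variables (R : realType) (n : nat).
Implicit Types (d : {poly R}) (B N : 'M[{poly R}]_n) (T : 'M[R]_n) (D : nat).
Local Notation "a %:F" := (FracField.tofrac a).
Local Notation toC := (map_poly (real_complex R)).
Local Notation mxC := (map_mx (real_complex R)).
Local Notation mxF := (map_mx (@FracField.tofrac {poly R})).
Local Notation mxP := (map_mx (@polyC R)).

Lemma real_root_conj (p : {poly R}) (s : R[i]) :
  root (toC p) s -> root (toC p) s^*%C.
Proof.
move=> /rootP ps; apply/rootP.
have -> : toC p = map_poly (@conjc R) (toC p).
  by rewrite -map_poly_comp; apply: eq_map_poly => x /=; rewrite oppr0.
by rewrite horner_map ps rmorph0.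
Qed.

(** The frequency conditions needed for t in [0, 1]: a nonzero determinant at
    infinity, where only the coefficients of degree deg d are seen, and at the
    nonnegative frequencies.  The negative ones follow since det (d I + t B) is
    a real polynomial. *)
Lemma hurwitz_det_pencil d B D :
  hurwitz d -> size d = D.+1 -> (forall i j, (size (B i j) <= D.+1)%N) ->
  (forall t : R, 0 <= t <= 1 -> \det ((d`_D)%:M + t *: top_mx D B) != 0) ->
  (forall t w : R, 0 <= t <= 1 -> 0 <= w ->
     \det ((toC d).[0 +i* w]%:M
           + t%:C *: map_mx (fun p => (toC p).[0 +i* w]) B) != 0) ->
  hurwitz (\det (d%:M + B)) /\ size (\det (d%:M + B)) = (n * D).+1.
Proof.
move=> hd sd sB top axis.
pose A (t : R) := d%:M + t%:P *: B.
have sA t i j : (size (A t i j) <= D.+1)%N.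
  rewrite !mxE mul_polyC; apply: leq_trans (size_polyD _ _) _.
  rewrite geq_max (leq_trans (size_scale_leq _ _)) // andbT.
  by case: (i == j); rewrite ?mulr1n ?mulr0n ?size_poly0 ?sd.
have topA t : top_mx D (A t) = (d`_D)%:M + t *: top_mx D B.
  apply/matrixP => i j; rewrite !mxE coefD coefCM; congr (_ + _).
  by case: (i == j); rewrite ?mulr1n ?mulr0n ?coef0.
have leadA t : 0 <= t <= 1 -> (\det (A t))`_(n * D) != 0.
  by move=> t01; have [_ ->] := det_top (sA t); rewrite topA top.
(* The outer variable is s, the inner variable is the homotopy parameter t. *)
pose Q : {poly {poly R}} :=
  \det ((map_poly (@polyC R) d)%:M + 'X%:P *: map_mx (map_poly (@polyC R)) B).
have evK (t : R) (p : {poly R}) :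
    map_poly (horner_eval t) (map_poly (@polyC R) p) = p.
  rewrite -map_poly_comp map_poly_id // => c _.
  by rewrite /= /horner_eval hornerC.
have QE t : map_poly (horner_eval t) Q = \det (A t).
  rewrite -det_map_mx map_mxD map_scalar_mx map_mxZ /= evK.
  congr (\det (_ + _)).
  rewrite map_polyC /= /horner_eval hornerX; congr (_ *: _).
  by rewrite -map_mx_comp map_mx_id // => p /=; exact: evK.
have sQ : (size Q <= (n * D).+1)%N.
  have [|//] := @det_top _ n D ((map_poly (@polyC R) d)%:M
    + 'X%:P *: map_mx (map_poly (@polyC R)) B).
  move=> i j; rewrite !mxE mul_polyC; apply: leq_trans (size_polyD _ _) _.
  rewrite geq_max (leq_trans (size_scale_leq _ _)) ?andbT; last first.
    by rewrite (leq_trans (size_poly _ _)).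
  case: (i == j); rewrite ?mulr1n ?mulr0n ?size_poly0 //.
  by rewrite (leq_trans (size_poly _ _)) ?sd.
have A1 : A 1 = d%:M + B by rewrite /A scale1r.
have lead1 := leadA 1; rewrite -A1; split; last first.
  apply/eqP; rewrite eqn_leq (det_top (sA 1)).1 ltnNge.
  apply: contra (lead1 _); last by rewrite ler01 lexx.
  by move=> h; rewrite nth_default.
have := @hurwitz_homotopy R Q (n * D) sQ; rewrite /= !QE; apply.
- by move=> t t01; rewrite QE leadA.
- have pos t w : 0 <= t <= 1 -> 0 <= w -> ~~ root (toC (\det (A t))) (0 +i* w).
    move=> t01 w0; rewrite rootE -horner_evalE -!det_map_mx.
    have -> // : map_mx (horner_eval (0 +i* w)) (map_mx toC (A t))
      = (toC d).[0 +i* w]%:M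
           + t%:C *: map_mx (fun p => (toC p).[0 +i* w]) B; last exact: axis.
    rewrite !map_mxD !map_scalar_mx !map_mxZ -map_mx_comp /=.
    by rewrite !horner_evalE map_polyC hornerC.
  move=> t t01 w; rewrite QE; have [w0|w0] := leP 0 w; first exact: pos.
  apply/negP => /real_root_conj /=.
  by apply/negP; apply: pos => //; rewrite oppr_ge0 ltW.
- rewrite /A scale0r addr0 det_scalar.
  elim: (n) => [|k IH]; last by rewrite exprS; exact: hurwitzM.
  by move=> s _; rewrite rmorph1 root1.
Qed.

(** With A = d I + B, the inverse of A / d is d adj(A) / det A, whose entries
    have numerators of degree at most
    deg d + (n - 1) deg d = n deg d = deg (det A). *)
Lemma RHinf_invmx_pencil d B D :
  size d = D.+1 -> (forall i j, (size (B i j) <= D.+1)%N) ->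
  hurwitz (\det (d%:M + B)) -> size (\det (d%:M + B)) = (n * D).+1 ->
  let M := 1%:M + (d%:F)^-1 *: map_mx (@FracField.tofrac _) B in
  M \in unitmx /\ RHinf (invmx M).
Proof.
move=> sd sB; set A := d%:M + B; set p := \det A => hp sp M.
have d0 : d%:F != 0 by rewrite tofrac_eq0 -size_poly_eq0 sd.
have p0 : p%:F != 0 by rewrite tofrac_eq0 hurwitz_neq0.
have sA i j : (size (A i j) <= D.+1)%N.
  rewrite !mxE; apply: leq_trans (size_polyD _ _) _; rewrite geq_max sB andbT.
  by case: (i == j); rewrite ?mulr1n ?mulr0n ?size_poly0 ?sd.
pose X := (d%:F / p%:F) *: map_mx (@FracField.tofrac _) (\adj A).
have MX : M *m X = 1%:M by exact: (@pencil_mul_inverse _ _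
  (@FracField.tofrac {poly R}) n d B d0 p0).
have [Mu _] := mulmx1_unit MX; split => //.
have -> : invmx M = X by rewrite -[RHS](mulKmx Mu) MX mulmx1.
apply: (@common_denominator_RHinf _ _ _ p (d *: \adj A)); split=> // i j.
- have i0 : (0 < n)%N by exact: leq_ltn_trans (ltn_ord i).
  rewrite mxE sp.
  apply: leq_trans (size_mul_top (eq_leq sd) (size_adj _ _ sA)) _.
  by rewrite -mulSn prednK.
- have -> : (d *: \adj A) i j = d * (\adj A) i j by rewrite mxE.
  have -> : X i j = d%:F / p%:F * ((\adj A) i j)%:F.
    by rewrite /X mxE [map_mx _ _ i j]mxE.
  by rewrite tofracM mulrAC.
Qed.

Lemma mxC_adj T : (mxC T)^t* = mxC T^T.
Proof. by apply/matrixP => i j; rewrite !mxE conj_Creal ?complex_real. Qed.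

Lemma congruence_top N T D : (forall i j, (size (N i j) <= D.+1)%N) ->
  (forall i j, (size (((mxP T)^T *m N *m mxP T) i j) <= D.+1)%N) /\
  top_mx D ((mxP T)^T *m N *m mxP T) = T^T *m top_mx D N *m T.
Proof.
move=> sN.
have sT (U : 'M[R]_n) i j : (size (mxP U i j) <= 1)%N.
  by rewrite mxE size_polyC_leq1.
have topT (U : 'M[R]_n) : top_mx 0 (mxP U) = U.
  by apply/matrixP => i j; rewrite !mxE coefC.
rewrite map_trmx.
have [s1 t1] := mulmx_top (sT T^T) sN.
have [s2 t2] := mulmx_top s1 (sT T).
by rewrite add0n addn0 in s2 t2; rewrite add0n in t1; rewrite t2 t1 !topT.
Qed.

Lemma freq_resp_finite (G : 'M[{fraction {poly R}}]_n) d N (w : R) :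
  common_denominator G d N ->
  freq_resp G w%:E =
  ((toC d).[0 +i* w])^-1 *: map_mx (fun p => (toC p).[0 +i* w]) N.
Proof.
case=> hd _ GE; apply/matrixP => i j; rewrite !mxE /=.
by rewrite (rf_evalE (GE i j)) ?hd //= mulrC.
Qed.

Lemma freq_resp_pinfty (G : 'M[{fraction {poly R}}]_n) d N D :
  common_denominator G d N -> size d = D.+1 ->
  freq_resp G +oo%E = (d`_D)%:C^-1 *: mxC (top_mx D N).
Proof.
move=> [hd sN GE] sd; apply/matrixP => i j; rewrite !mxE.
by rewrite (rf_freq_pinfty (GE i j) _ sd) -?sd // mulrC.
Qed.

Lemma closed_loop_pencil (G K : 'M[{fraction {poly R}}]_n) d1 d2 N1 N2
    (T S : 'M[R]_n) :
  common_denominator G d1 N1 -> common_denominator K d2 N2 ->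
  (rf_const_mx T)^T *m G *m rf_const_mx T
    *m ((rf_const_mx S)^T *m K *m rf_const_mx S)
  = ((d1 * d2)%:F)^-1 *:
     mxF ((mxP T)^T *m N1 *m mxP T *m ((mxP S)^T *m N2 *m mxP S)).
Proof.
have cd (H : 'M[{fraction {poly R}}]_n) d N :
    common_denominator H d N -> H = (d%:F)^-1 *: mxF N.
  by case=> _ _ HE; apply/matrixP => i j; rewrite HE !mxE mulrC.
have cst U : rf_const_mx U = mxF (mxP U).
  by apply/matrixP => i j; rewrite !mxE.
move=> /cd -> /cd ->; rewrite !cst.
by rewrite !map_mxM !map_trmx -!(scalemxAr, scalemxAl) scalerA tofracM invfM.
Qed.

End ClosedLoop.

Unset Implicit Arguments.

Theorem mainTheorem4 (R : realType) (n : nat)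
    (G K : 'M[{fraction {poly R}}]_n)
    (HG : RHinf G) (HK : RHinf K)
    (Hzeps : exists (z : \bar R -> R[i]) (eps : R),
      [/\ Linfty (fun w : R => z w%:E),
          0 < eps
        & forall w : \bar R, (0 <= w)%E ->
            let Gw := freq_resp G w in
            let Kw := freq_resp K w in
            let Pw := multiplier n (z w) in
               (loewner_le (graph_formG Pw Gw) (- (eps%:C *: (Gw^t* *m Gw)))
                /\ loewner_le 0 (graph_formK Pw Kw))
            \/ (loewner_le (graph_formG Pw Gw) 0
                /\ loewner_le (eps%:C *: (Kw^t* *m Kw)) (graph_formK Pw Kw))]) :
  forall T S : 'M[R]_n, T \in unitmx -> S \in unitmx ->
    let M := 1%:M + (rf_const_mx T)^T *m G *m rf_const_mx T
                     *m ((rf_const_mx S)^T *m K *m rf_const_mx S) in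
    M \in unitmx /\ RHinf (invmx M).
Proof.
move=> T S _ _ M; case: Hzeps => z [eps [_ eps0 Hz]].
have [d1 [N1 cG]] := RHinf_common_denominator HG.
have [d2 [N2 cK]] := RHinf_common_denominator HK.
have [hd1 sN1 _] := cG; have [hd2 sN2 _] := cK.
have size_predK (d : {poly R}) : hurwitz d -> size d = (size d).-1.+1.
  by move=> hd; rewrite prednK // size_poly_gt0 hurwitz_neq0.
have sd1 := size_predK _ hd1; have sd2 := size_predK _ hd2.
set D1 := (size d1).-1 in sd1; set D2 := (size d2).-1 in sd2.
rewrite sd1 in sN1; rewrite sd2 in sN2.
have [sB1 topB1] := congruence_top T sN1.
have [sB2 topB2] := congruence_top S sN2.
have [sB topB] := mulmx_top sB1 sB2.
set B := _ *m _ in sB topB.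
have sd : size (d1 * d2)%R = (D1 + D2).+1.
  by rewrite size_mul ?hurwitz_neq0 // sd1 sd2 addnS.
(* One statement for finite frequencies and for +oo: a, b and X, Y are the
   values at j w, respectively the top coefficients, of d1, d2 and N1, N2. *)
have nonsing (w : \bar R) (a b : R[i]) (X Y : 'M[R[i]]_n) (t : R) :
    (0 <= w)%E -> 0 <= t -> a != 0 -> b != 0 ->
    freq_resp G w = a^-1 *: X -> freq_resp K w = b^-1 *: Y ->
    \det ((a * b)%:M + t%:C *:
      (map_mx (real_complex R) T^T *m X *m map_mx (real_complex R) T *m
       (map_mx (real_complex R) S^T *m Y *m map_mx (real_complex R) S))) != 0.
  move=> w0 t0 a0 b0 GE KE; rewrite feedback_det // -GE -KE -!mxC_adj.
  rewrite mulf_neq0 ?expf_neq0 ?mulf_neq0 //.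
  exact: multiplier_nonsingular eps0 t0 (Hz w w0).
have [||hp sp] := @hurwitz_det_pencil R n (d1 * d2) B (D1 + D2)
  (hurwitzM hd1 hd2) sd sB.
- move=> t /andP[t0 _]; rewrite topB topB1 topB2 coefM_top ?sd1 ?sd2 //.
  rewrite -(fmorph_eq0 (real_complex R)) -det_map_mx.
  rewrite map_mxD map_scalar_mx map_mxZ !map_mxM /= rmorphM /=.
  have lead (d : {poly R}) D : size d = D.+1 -> (d`_D)%:C != 0.
    move=> sdD; rewrite fmorph_eq0 -[D]/(D.+1.-1) -sdD lead_coef_eq0.
    by rewrite -size_poly_eq0 sdD.
  apply: (nonsing +oo%E) => //; first exact: lead.
  + exact: lead.
  + exact: freq_resp_pinfty.
  + exact: freq_resp_pinfty.
- move=> t w /andP[t0 _] w0.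
  have den0 (d : {poly R}) : hurwitz d ->
      (map_poly (real_complex R) d).[0 +i* w] != 0 by apply.
  pose ev (p : {poly R}) := (map_poly (real_complex R) p).[0 +i* w].
  have evM : map_mx ev B = map_mx (real_complex R) T^T *m map_mx ev N1 *m
      map_mx (real_complex R) T *m (map_mx (real_complex R) S^T *m
      map_mx ev N2 *m map_mx (real_complex R) S).
    have cst (U : 'M[R]_n) :
        map_mx ev (map_mx (@polyC R) U) = map_mx (real_complex R) U.
      by apply/matrixP => i j; rewrite !mxE /ev map_polyC hornerC.
    rewrite -!cst -!map_trmx.
    have evE (A : 'M[{poly R}]_n) : map_mx ev A
        = map_mx (horner_eval (0 +i* w)) (map_mx (map_poly (real_complex R)) A).
      by rewrite -map_mx_comp.
    by rewrite !evE /B !map_mxM -!map_trmx.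
  rewrite -/ev evM rmorphM hornerM.
  apply: (nonsing w%:E) => //; try exact: den0.
  + exact: freq_resp_finite cG.
  + exact: freq_resp_finite cK.
rewrite /M (closed_loop_pencil T S cG cK).
exact: RHinf_invmx_pencil sd sB hp sp.
Qed.
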